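(* Consider the optimal promotion $\mathbf{s}^{\rm opt}=(s_p^{\rm opt},s_q^{\rm opt})$ in the Bass model on the homogeneous infinite line, with $p(s_p)=p_0+b_p\sqrt{s_p}$ and $q(s_q)=q_0+b_q\sqrt{s_q}$, and let $f^{\rm opt}$ be the corresponding adoption level. 1. If $T<\infty$, then $f^{\rm opt}(T)<1$. Hence, $s_p^{\rm opt}(T)>0$ and $s_q^{\rm opt}(T)>0$. 2. If $T=\infty$, then $\lim_{t\to\infty}f^{\rm opt}(t)=1$. Hence, $\lim_{t\to\infty}s_p^{\rm opt}(t)=\lim_{t\to\infty}s_q^{\rm opt}(t)=0$.
   Context: Bass model on the homogeneous infinite line $\mathbb{Z}$: all nodes are nonadopters at $t=0$; under the promotion $\mathbf{s}(t)=(s_p(t),s_q(t))$ (piecewise-continuous functions $[0,T]\to[0,\infty)$) a nonadopter $j$ adopts at rate $p(s_p(t))+\frac{q(s_q(t))}{2}\big(X_{j-1}(t)+X_{j+1}(t)\big)$, where $X_i(t)\in\{0,1\}$ is the adoption state of node $i$; adopters remain adopters; $f(t)=\mathbf{E}[X_j(t)]$ is the expected adoption level. The optimal promotion maximizes $\Pi[\mathbf{s}]=\int_0^Te^{-\theta t}\big(\gamma\frac{df}{dt}-s_p(t)-s_q(t)\big)dt$, and is given by $$s_p^{\rm opt}(t)=\frac{b_p^2}{4}\Big((\gamma+\Psi_1e^{\theta t})(1-f)+\Psi_2e^{\theta t}\Big)^2,\qquad s_q^{\rm opt}(t)=\frac{b_q^2}{4}\Big((\gamma+\Psi_1e^{\theta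 t})(1-f)(1-e^{-y})\Big)^2,$$ where $f=f^{\rm opt},y,\Psi_1,\Psi_2$ solve, with $s_p=s_p^{\rm opt}$, $s_q=s_q^{\rm opt}$, $$\frac{df}{dt}=\big(p(s_p)+q(s_q)(1-e^{-y})\big)(1-f),\quad f(0)=0,\qquad \frac{dy}{dt}=p(s_p),\quad y(0)=0,$$ $$\frac{d\Psi_1}{dt}=(\gamma e^{-\theta t}+\Psi_1)\big(p(s_p)+q(s_q)(1-e^{-y})\big),\quad \Psi_1(T)=0,\qquad \frac{d\Psi_2}{dt}=-(\gamma e^{-\theta t}+\Psi_1)(1-f)q(s_q)e^{-y},\quad \Psi_2(T)=0.$$ Here $p_0,q_0,b_p,b_q,\gamma>0$ are constants, $\theta\ge0$ is the discount rate (positive if $T=\infty$), and $T\in(0,\infty]$ is the planning horizon (if $T=\infty$, terminal conditions are understood as $t\to\infty$). *)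

(* Defs.v *)
From mathcomp Require Import all_boot all_order all_algebra.
From mathcomp Require Import all_classical all_reals all_analysis.
Import Order.TTheory GRing.Theory Num.Theory.
Import numFieldNormedType.Exports.

Set Implicit Arguments.
Unset Strict Implicit.
Unset Printing Implicit Defensive.

Local Open Scope classical_set_scope.
Local Open Scope ring_scope.

(* [0, T] when T is finite, [0, +oo[ when T = +oo. *)
Definition horizon (R : realType) (T : \bar R) : set R :=
  [set t | 0 <= t /\ (t%:E <= T)%E].

(* On an infinite horizon, discontinuities may accumulate only at infinity. *)
Definition piecewise_continuous (R : realType) (T : \bar R) (s : R -> R) : Prop :=
  forall r : R, 0 < r -> (r%:E <= T)%E ->
  [/\ exists D : seq R, forall t, 0 < t < r -> t \notin D -> {for t, continuous s},
      forall t, 0 <= t < r -> cvg (s @ t^'+) &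
      forall t, 0 < t <= r -> cvg (s @ t^'-)].

Definition promotion (R : realType) (T : \bar R) (s : R -> R) : Prop :=
  piecewise_continuous T s /\ forall t, horizon T t -> 0 <= s t.

Section BassLine.
Context (R : realType) (d : measure_display) (Omega : measurableType d).
Implicit Types (X : int -> R -> Omega -> bool) (p q sp sq : R -> R).

Definition adoption_rate p q sp sq X (j : int) (t : R) (w : Omega) : R :=
  p (sp t) + q (sq t) / 2 * ((X (j - 1) t w)%:R + (X (j + 1) t w)%:R).

(* The sigma-algebra generated by the states of all nodes up to time t. *)
Definition history X (t : R) : set (set Omega) :=
  <<s [set A | exists i r, 0 <= r <= t /\ A = [set w | X i r w]] >>.

Definition adopts_at X (j : int) (t : R) (w : Omega) : Prop :=
  X j t w /\ forall r, 0 <= r < t -> ~~ X j r w.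

(* bass_rate says that, relative to the history of the whole line, node j has
   the stochastic intensity (1 - X_j(t)) * adoption_rate: it is the integrated
   form of "given the history up to t, a nonadopter j adopts during
   (t, t + dt) with probability adoption_rate * dt".  Intensities do not
   exclude that two nodes jump together, hence bass_single. *)
Record bass_process (T : \bar R) p q sp sq (P : probability Omega R) X : Prop :=
  BassProcess {
    bass_measurable : forall j t, horizon T t -> measurable_fun setT (X j t);
    bass_init : forall j w, X j 0 w = false;
    bass_monotone : forall j r t w, 0 <= r <= t -> horizon T t ->
      X j r w -> X j t w;
    bass_right_continuous : forall j t w, horizon T t -> (t%:E < T)%E ->
      \forall u \near t^'+, X j u w = X j t w;
    bass_single : {ae P, forall w, forall i j t, i <> j -> horizon T t ->
      ~ (adopts_at X i t w /\ adopts_at X j t w)};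
    bass_rate : forall j r t B, 0 <= r <= t -> horizon T t -> history X r B ->
      P (B `&` [set w | ~~ X j r w] `&` [set w | X j t w]) =
      (\int[lebesgue_measure]_(u in `[r, t])
         \int[P]_(w in B `&` [set w | ~~ X j r w])
           ((1 - (X j u w)%:R) * adoption_rate p q sp sq X j u w)%:E)%E
  }.

End BassLine.

(* f(t) = E[X_j(t)] on [0, T]; the value does not depend on the node j. *)
Definition adoption_level (R : realType) (T : \bar R) (p q sp sq f : R -> R) : Prop :=
  exists (d : measure_display) (Omega : measurableType d)
         (P : probability Omega R) (X : int -> R -> Omega -> bool),
    bass_process T p q sp sq P X /\
    forall j t, horizon T t -> 'E_P[fun w => (X j t w)%:R%R]%E = (f t)%:E.

(* The value may be -oo when T = +oo; the positive part of the integrand is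
   always integrable, since f is monotone with values in [0, 1]. *)
Definition profit (R : realType) (T : \bar R) (gamma theta : R)
    (sp sq f : R -> R) : \bar R :=
  (\int[lebesgue_measure]_(t in horizon T)
     (expR (- theta * t) * (gamma * derive1 f t - sp t - sq t))%:E)%E.

Definition optimal_promotion (R : realType) (T : \bar R) (p q : R -> R)
    (gamma theta : R) (sp sq f : R -> R) : Prop :=
  [/\ promotion T sp, promotion T sq, adoption_level T p q sp sq f &
      forall sp' sq' f', promotion T sp' -> promotion T sq' ->
        adoption_level T p q sp' sq' f' ->
        (profit T gamma theta sp' sq' f' <= profit T gamma theta sp sq f)%E].

Definition sqrt_rate (R : realType) (a b s : R) : R := a + b * Num.sqrt s.

Definition terminal_value (R : realType) (T : \bar R) (g : R -> R) (l : R) : Prop :=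
  match T with
  | r%:E => g r = l
  | +oo%E => g t @[t --> +oo] --> l
  | -oo%E => False
  end.

Definition solves_ode (R : realType) (T : \bar R) (g rhs : R -> R) : Prop :=
  {within horizon T, continuous g} /\
  forall t, 0 < t -> (t%:E < T)%E -> is_derive t 1 g (rhs t).

(* State (f, y) and costate (Psi1, Psi2) equations, closed by the expressions
   of the optimal promotion, for p(s) = p0 + bp sqrt s, q(s) = q0 + bq sqrt s. *)
Record optimality_system (R : realType) (T : \bar R)
    (p0 q0 bp bq gamma theta : R) (sp sq f y Psi1 Psi2 : R -> R) : Prop :=
  OptimalitySystem {
    opt_sp : forall t, horizon T t ->
      sp t = bp ^+ 2 / 4 *
        ((gamma + Psi1 t * expR (theta * t)) * (1 - f t)
         + Psi2 t * expR (theta * t)) ^+ 2;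
    opt_sq : forall t, horizon T t ->
      sq t = bq ^+ 2 / 4 *
        ((gamma + Psi1 t * expR (theta * t)) * (1 - f t)
         * (1 - expR (- y t))) ^+ 2;
    opt_f : solves_ode T f (fun t =>
      (sqrt_rate p0 bp (sp t) + sqrt_rate q0 bq (sq t) * (1 - expR (- y t)))
      * (1 - f t));
    opt_f0 : f 0 = 0;
    opt_y : solves_ode T y (fun t => sqrt_rate p0 bp (sp t));
    opt_y0 : y 0 = 0;
    opt_Psi1 : solves_ode T Psi1 (fun t =>
      (gamma * expR (- theta * t) + Psi1 t) *
      (sqrt_rate p0 bp (sp t) + sqrt_rate q0 bq (sq t) * (1 - expR (- y t))));
    opt_Psi1T : terminal_value T Psi1 0;
    opt_Psi2 : solves_ode T Psi2 (fun t =>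
      - (gamma * expR (- theta * t) + Psi1 t) * (1 - f t)
      * sqrt_rate q0 bq (sq t) * expR (- y t));
    opt_Psi2T : terminal_value T Psi2 0
  }.

(* Main.v *)
(* Put a = p(s_p) + q(s_q)(1 - e^-y) and g = 1 - f, so that g' = - a g.
   - T finite: a is continuous on [0, T], hence bounded by some M, and then
     g^2 e^(2Mt) is nondecreasing, so g never vanishes and f stays below 1.
   - T infinite: a >= p0 gives |g| <= e^(-p0 t), whence f --> 1. In
     W = (gamma e^(- theta t) + Psi1) g the hazard a cancels:
     W' = - theta gamma e^(- theta t) g, and W --> 0 at infinity, so that
     W = O(e^(-(theta + p0) t)). The same bound then passes to Psi2, because
     Psi2' = - W q(s_q) e^-y with s_q bounded. Multiplied by e^(theta t), both
     contributions to the promotions decay like e^(-p0 t). *)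

Require Import Defs.
From mathcomp Require Import all_boot all_order all_algebra.
From mathcomp Require Import all_classical all_reals all_analysis.
From mathcomp Require Import ring.
Import Order.TTheory GRing.Theory Num.Theory.
Import numFieldNormedType.Exports.

Set Implicit Arguments.
Unset Strict Implicit.

Local Open Scope classical_set_scope.
Local Open Scope ring_scope.

(** * Closure of [solves_ode] under sums, products and scaling *)

Lemma solves_ode_eq (R : realType) (T : \bar R) (g r1 r2 : R -> R) :
  (forall t, r1 t = r2 t) -> solves_ode T g r1 -> solves_ode T g r2.
Proof. by move=> /funext ->. Qed.

Lemma solves_ode_continuous_derive (R : realType) (T : \bar R) (g r : R -> R) :
  (forall t : R, is_derive t 1 g (r t)) -> solves_ode T g r.
Proof.
move=> gr; split=> [|t _ _]; last exact: gr.
apply: continuous_subspaceT => t.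
by apply/differentiable_continuous/derivable1_diffP; have [] := gr t.
Qed.

Lemma solves_ode_cst (R : realType) (T : \bar R) (c : R) :
  solves_ode T (fun=> c) (fun=> 0).
Proof. by apply: solves_ode_continuous_derive => t; exact: is_derive_cst. Qed.

Lemma solves_ode_expRM (R : realType) (T : \bar R) (k : R) :
  solves_ode T (fun t => expR (k * t)) (fun t => k * expR (k * t)).
Proof.
apply: solves_ode_continuous_derive => t.
have -> : (fun t => expR (k * t)) = expR \o (k \*: (@id R)) by [].
by apply: is_derive_eq; rewrite /= /GRing.scale /= mulr1 mulrC.
Qed.

Lemma solves_odeD (R : realType) (T : \bar R) (g1 r1 g2 r2 : R -> R) :
  solves_ode T g1 r1 -> solves_ode T g2 r2 ->
  solves_ode T (fun t => g1 t + g2 t) (fun t => r1 t + r2 t).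
Proof.
move=> [c1 d1] [c2 d2]; split=> [t|t t0 tT].
  exact: continuousD (c1 t) (c2 t).
have := d1 t t0 tT; have := d2 t t0 tT => ? ?.
exact: is_deriveD.
Qed.

Lemma solves_odeM (R : realType) (T : \bar R) (g1 r1 g2 r2 : R -> R) :
  solves_ode T g1 r1 -> solves_ode T g2 r2 ->
  solves_ode T (fun t => g1 t * g2 t) (fun t => g1 t * r2 t + g2 t * r1 t).
Proof.
move=> [c1 d1] [c2 d2]; split=> [t|t t0 tT].
  exact: continuousM (c1 t) (c2 t).
have := d1 t t0 tT; have := d2 t t0 tT => ? ?.
exact: is_deriveM.
Qed.

Lemma solves_odeZ (R : realType) (T : \bar R) (c : R) (g r : R -> R) :
  solves_ode T g r -> solves_ode T (fun t => c * g t) (fun t => c * r t).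
Proof.
move=> /(solves_odeM (solves_ode_cst T c)); apply: solves_ode_eq => t.
by rewrite mulr0 addr0.
Qed.

(** * Monotonicity and exponential comparison on the horizon *)

Lemma itv_horizon (R : realType) (T : \bar R) (a b : R) :
  0 <= a -> (b%:E <= T)%E -> `[a, b] `<=` horizon T.
Proof.
move=> a0 bT t /=; rewrite in_itv/= => /andP[at_ tb]; split.
  exact: le_trans at_.
by apply: le_trans bT; rewrite lee_fin.
Qed.

(** Mean value theorem: a sign of the derivative in the interior is enough, because continuity holds
    up to the ends of the horizon. So [a = 0] and [b = T] are allowed. *)
Lemma solves_ode_nondecreasing (R : realType) (T : \bar R) (g r : R -> R)
    (a b : R) :
  solves_ode T g r -> (forall t, 0 < t -> (t%:E < T)%E -> 0 <= r t) ->
  0 <= a -> a <= b -> (b%:E <= T)%E -> g a <= g b.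
Proof.
move=> [gc gd] r0 a0; rewrite le_eqVlt => /predU1P[->//|ab] bT.
have inT t : t \in `]a, b[ -> 0 < t /\ (t%:E < T)%E.
  rewrite in_itv/= => /andP[at_ tb]; split; first exact: le_lt_trans at_.
  by apply: lt_le_trans bT; rewrite lte_fin.
have [||t tab E] := @MVT R g r a b ab.
- by move=> t /inT[]; exact: gd.
- exact: continuous_subspaceW (itv_horizon a0 bT) gc.
- have [t0 tT] := inT _ tab.
  by rewrite -subr_ge0 E mulr_ge0 ?r0// subr_ge0 ltW.
Qed.

Lemma solves_ode_nonincreasing (R : realType) (T : \bar R) (g r : R -> R)
    (a b : R) :
  solves_ode T g r -> (forall t, 0 < t -> (t%:E < T)%E -> r t <= 0) ->
  0 <= a -> a <= b -> (b%:E <= T)%E -> g b <= g a.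
Proof.
move=> /(solves_odeZ (-1)) gr r0 a0 ab bT.
have := solves_ode_nondecreasing gr _ a0 ab bT.
rewrite !mulN1r lerN2; apply => t t0 tT.
by rewrite mulN1r oppr_ge0 r0.
Qed.

(** Squaring makes the argument blind to the sign of [g]: the derivative is [k - a t] times a
    nonnegative quantity, so comparing [a] with the constant [k] decides the monotonicity. Both
    exponential bounds below follow from it. *)
Lemma solves_ode_sqr_expRM (R : realType) (T : \bar R) (g a : R -> R) (k : R) :
  solves_ode T g (fun t => - a t * g t) ->
  solves_ode T (fun t => g t ^+ 2 * expR (2 * k * t))
    (fun t => 2 * (k - a t) * (g t ^+ 2 * expR (2 * k * t))).
Proof.
move=> ga.
have := solves_odeM (solves_odeM ga ga) (solves_ode_expRM T (2 * k)).
under eq_fun do rewrite -expr2.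
by apply: solves_ode_eq => t; ring.
Qed.

Lemma solves_ode_sqr_ge (R : realType) (T : \bar R) (g a : R -> R) (k t : R) :
  solves_ode T g (fun t => - a t * g t) ->
  (forall t, 0 < t -> (t%:E < T)%E -> a t <= k) -> horizon T t ->
  g 0 ^+ 2 <= g t ^+ 2 * expR (2 * k * t).
Proof.
move=> /(solves_ode_sqr_expRM k) h ak [t0 tT].
have := solves_ode_nondecreasing h _ (lexx 0) t0 tT.
rewrite mulr0 expR0 mulr1; apply => u u0 uT.
apply: mulr_ge0; last by rewrite mulr_ge0 ?sqr_ge0 ?expR_ge0.
by rewrite mulr_ge0// subr_ge0 ak.
Qed.

Lemma solves_ode_norm_le (R : realType) (T : \bar R) (g a : R -> R) (k t : R) :
  solves_ode T g (fun t => - a t * g t) ->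
  (forall t, 0 < t -> (t%:E < T)%E -> k <= a t) -> horizon T t ->
  `|g t| <= `|g 0| * expR (- k * t).
Proof.
move=> /(solves_ode_sqr_expRM k) h ak [t0 tT].
have : g t ^+ 2 * expR (2 * k * t) <= g 0 ^+ 2.
  have := solves_ode_nonincreasing h _ (lexx 0) t0 tT.
  rewrite mulr0 expR0 mulr1; apply => u u0 uT.
  apply: mulr_le0_ge0; last by rewrite mulr_ge0 ?sqr_ge0 ?expR_ge0.
  by rewrite pmulr_rle0// subr_le0 ak.
(* The weight is the square of [expR (k * t)], so taking square roots turns the bound on squares
   into one on norms. *)
rewrite -[2 * k * t]mulrA expRM_natl -exprMn => /ler_wsqrtr.
rewrite !sqrtr_sqr normrM (ger0_norm (expR_ge0 _)).
by rewrite mulNr expRN ler_pdivlMr// expR_gt0.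
Qed.

(** * Exponential decay towards a zero limit at infinity *)

Lemma cvg_expRN (R : realType) (k : R) :
  0 < k -> expR (- k * t) @[t --> +oo] --> (0 : R).
Proof.
move=> k0; under eq_fun do rewrite mulNr.
apply: (cvg_comp (fun t : R => k * t) (fun t => expR (- t)) _ (@cvgr_expR R)).
exact: (gt0_cvgMry k0 cvg_id).
Qed.

(** Integration backwards from infinity: g - (C / k) e^(-kt) has derivative r + C e^(-kt) >= 0 and
    tends to 0, so it is nonpositive throughout. The one-sided form is later applied to both [g] and
    [- g]. *)
Lemma solves_ode_cvg0_le (R : realType) (g r : R -> R) (C k t : R) :
  0 < k -> solves_ode +oo%E g r -> g t @[t --> +oo] --> (0 : R) ->
  (forall t, 0 < t -> - (C * expR (- k * t)) <= r t) -> 0 <= t ->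
  g t <= C / k * expR (- k * t).
Proof.
move=> k0 gr g0 rC t0.
have := solves_odeD gr
  (solves_odeZ (- (C / k)) (solves_ode_expRM _ (- k))) => h.
have lim : g t + - (C / k) * expR (- k * t) @[t --> +oo] --> (0 : R).
  rewrite -[0]addr0; apply: cvgD => //.
  by rewrite -(mulr0 (- (C / k))); apply: cvgMl_tmp; exact: cvg_expRN.
rewrite -subr_le0 -mulNr.
apply: cvgr_to_ge lim _; near=> u.
apply: solves_ode_nondecreasing h _ t0 _ _ => //; last by rewrite leey.
move=> v v0 _.
have -> : r v + - (C / k) * (- k * expR (- k * v)) = r v + C * expR (- k * v).
  by field; rewrite gt_eqF.
by rewrite -lerBlDr sub0r rC.
Unshelve. all: by end_near.
Qed.

Lemma solves_ode_cvg0_norm (R : realType) (g r : R -> R) (C k t : R) :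
  0 < k -> solves_ode +oo%E g r -> g t @[t --> +oo] --> (0 : R) ->
  (forall t, 0 < t -> `|r t| <= C * expR (- k * t)) -> 0 <= t ->
  `|g t| <= C / k * expR (- k * t).
Proof.
move=> k0 gr g0 rC t0; rewrite ler_norml lerNl; apply/andP; split; last first.
  apply: solves_ode_cvg0_le gr g0 _ t0 => // u u0.
  by have := rC u u0; rewrite ler_norml => /andP[].
rewrite -mulN1r; apply: solves_ode_cvg0_le (solves_odeZ (-1) gr) _ _ t0 => //.
  by rewrite -(mulr0 (-1)); exact: cvgMl_tmp.
move=> u u0; rewrite mulN1r lerN2.
by have := rC u u0; rewrite ler_norml => /andP[].
Qed.

Lemma cvg0_expR_bound (R : realType) (g : R -> R) (C k : R) : 0 < k ->
  (forall t, 0 <= t -> `|g t| <= C * expR (- k * t)) ->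
  g t @[t --> +oo] --> (0 : R).
Proof.
move=> k0 gC; apply/norm_cvg0P.
apply: (@squeeze_cvgr _ _ _ _ (fun=> 0) (fun t => C * expR (- k * t))).
- near=> t; rewrite normr_ge0 gC//; near: t; exact: nbhs_pinfty_ge.
- exact: cvg_cst.
- by rewrite -(mulr0 C); apply: cvgMl_tmp; exact: cvg_expRN.
Unshelve. all: by end_near.
Qed.

(** * Bounds on exposure, hazard and nonadopters in the optimality system *)

Section OptimalitySystem.
Context (R : realType) (T : \bar R) (p0 q0 bp bq gamma theta : R).
Context (sp sq f y Psi1 Psi2 : R -> R).
Context (p0_gt0 : 0 < p0) (q0_gt0 : 0 < q0) (bp_gt0 : 0 < bp) (bq_gt0 : 0 < bq).
Context (gamma_gt0 : 0 < gamma).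
Context (sys : optimality_system T p0 q0 bp bq gamma theta sp sq f y Psi1 Psi2).

Let q t := sqrt_rate q0 bq (sq t).
Let hazard t := sqrt_rate p0 bp (sp t) + q t * (1 - expR (- y t)).
Let value t := (gamma + Psi1 t * expR (theta * t)) * (1 - f t).

(** For negative [s] this rests on [Num.sqrt] being 0 there. *)
Let sqrt_rate_ge (a b s : R) : 0 < b -> a <= sqrt_rate a b s.
Proof. by move=> b0; rewrite lerDl mulr_ge0 ?sqrtr_ge0 ?ltW. Qed.

(** The rate of [y] is at least [p0]. This keeps 1 - e^(-y) in [0, 1], and at a finite terminal time
    makes it strictly positive. *)
Lemma exposure_ge (t : R) : horizon T t -> p0 * t <= y t.
Proof.
move=> [t0 tT].
have idT : solves_ode T (fun t => t) (fun=> 1).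
  by apply: solves_ode_continuous_derive => u; exact: is_derive_id.
have := solves_ode_nondecreasing
  (solves_odeD (opt_y sys) (solves_odeZ (- p0) idT)) _ (lexx 0) t0 tT.
rewrite (opt_y0 sys) mulr0 addr0 [- p0 * t]mulNr subr_ge0; apply=> u _ _.
by rewrite mulr1 subr_ge0 sqrt_rate_ge.
Qed.

Lemma exposed_itv (t : R) : horizon T t -> 0 <= 1 - expR (- y t) <= 1.
Proof.
move=> tT; rewrite subr_ge0 gerBl expR_ge0 andbT -expR0 ler_expR oppr_le0.
apply: le_trans (exposure_ge tT).
by case: tT => t0 _; rewrite mulr_ge0// ltW.
Qed.

Lemma hazard_ge (t : R) : horizon T t -> p0 <= hazard t.
Proof.
move=> /exposed_itv /andP[y0 _].
apply: le_trans (sqrt_rate_ge p0 (sp t) bp_gt0) _; rewrite lerDl mulr_ge0//.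
by apply: le_trans (sqrt_rate_ge q0 (sq t) bq_gt0); exact: ltW.
Qed.

Lemma nonadopters_ode :
  solves_ode T (fun t => 1 - f t) (fun t => - hazard t * (1 - f t)).
Proof.
have := solves_odeD (solves_ode_cst T 1) (solves_odeZ (-1) (opt_f sys)).
under eq_fun do rewrite mulN1r.
by apply: solves_ode_eq => t; rewrite /hazard /q; ring.
Qed.

Lemma hazard_bounded (T0 : R) :
  0 < T0 -> T = T0%:E -> exists M, forall t, horizon T t -> hazard t <= M.
Proof.
move=> T0_gt0 TE.
(* [H] is the hazard with the formulas for [sp] and [sq] substituted. They hold on the horizon only,
   where [H] is visibly built from the continuous state and costate, so that it attains a maximum on
   the compact interval. *)
pose H t := p0
  + bp * Num.sqrt (bp ^+ 2 / 4 * (value t + Psi2 t * expR (theta * t)) ^+ 2)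
  + (q0 + bq * Num.sqrt (bq ^+ 2 / 4 * (value t * (1 - expR (- y t))) ^+ 2))
    * (1 - expR (- y t)).
have hazE t : horizon T t -> hazard t = H t.
  by move=> tT; rewrite /hazard /q /sqrt_rate (opt_sp sys tT) (opt_sq sys tT).
have cH : {within horizon T, continuous H}.
  have [cf _] := opt_f sys; have [cy _] := opt_y sys.
  have [c1 _] := opt_Psi1 sys; have [c2 _] := opt_Psi2 sys.
  have [ce _] := solves_ode_expRM T theta.
  pose cont (g : R -> R) := {within horizon T, continuous g}.
  have cC c : cont (fun=> c) by move=> t; exact: cvg_cst.
  have cD g h : cont g -> cont h -> cont (fun t => g t + h t).
    by move=> cg ch t; exact: continuousD (cg t) (ch t).
  have cM g h : cont g -> cont h -> cont (fun t => g t * h t).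
    by move=> cg ch t; exact: continuousM (cg t) (ch t).
  have cN g : cont g -> cont (fun t => - g t).
    by move=> cg t; exact: continuousN (cg t).
  have comp (g h : R -> R) : cont g -> continuous h -> cont (h \o g).
    by move=> cg ch; apply: within_continuous_comp cg => u _; exact: ch.
  (* The common shape of both rates, with [e] standing for [bp] or [bq]. *)
  have csqrt c e g :
      cont g -> cont (fun t => c + e * Num.sqrt (e ^+ 2 / 4 * g t ^+ 2)).
    move=> cg; apply/cD => //; apply/cM => //.
    apply: (comp (fun t => e ^+ 2 / 4 * g t ^+ 2) Num.sqrt).
      by apply/cM => //; exact/cM.
    exact: sqrt_continuous.
  have cy1 : cont (fun t => 1 - expR (- y t)).
    apply/cD => //; apply/cN.
    by apply: (comp (fun t => - y t) expR); [exact/cN|exact: continuous_expR].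
  have cv : cont value.
    by apply/cM; [apply/cD => //; exact/cM|apply/cD => //; exact/cN].
  apply/cD; first by apply/csqrt; apply/cD => //; exact/cM.
  by apply/cM => //; apply/csqrt; exact/cM.
have sub : `[0, T0] `<=` horizon T by apply: itv_horizon => //; rewrite TE.
have [c _ cM] := EVT_max (ltW T0_gt0) (continuous_subspaceW sub cH).
exists (H c) => t tT; rewrite hazE//; apply/cM.
by rewrite in_itv/=; move: tT; rewrite /horizon/= TE lee_fin => -[-> ->].
Qed.

Lemma adoption_lt1 (T0 : R) : 0 < T0 -> T = T0%:E -> f T0 < 1.
Proof.
move=> T0_gt0 TE.
have [M hM] := hazard_bounded T0_gt0 TE.
have hM' u : 0 < u -> (u%:E < T)%E -> hazard u <= M.
  by move=> u0 uT; apply: hM; split; exact: ltW.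
have f_neq1 t : horizon T t -> 1 - f t != 0.
  move=> tT; apply/eqP => ft.
  (* At a zero of [1 - f] this lower bound would read 1 <= 0. *)
  have := solves_ode_sqr_ge nonadopters_ode hM' tT.
  by rewrite ft (opt_f0 sys) subr0 expr1n expr0n mul0r ler10.
have sub : `[0, T0] `<=` horizon T by apply: itv_horizon => //; rewrite TE.
(* [1 - f] equals 1 at time 0; were it nonpositive at [T0], it would vanish in between. *)
rewrite ltNge; apply/negP => f_ge1.
have [cf _] := nonadopters_ode.
have [|||c] := @IVT R (fun t => 1 - f t) 0 T0 0.
- exact: ltW.
- exact: continuous_subspaceW sub cf.
- rewrite (opt_f0 sys) subr0 ge_min le_max ler01 andbT.
  by rewrite subr_le0 f_ge1 orbT.
- by move=> /sub /f_neq1 /eqP.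
Qed.

(** The function is e^(- theta t) [value t]. In this discounted form the hazards of [1 - f] and
    [Psi1] cancel, and only the derivative of the discount factor survives. *)
Lemma value_ode : solves_ode T
  (fun t => (gamma * expR (- theta * t) + Psi1 t) * (1 - f t))
  (fun t => - (theta * gamma * expR (- theta * t) * (1 - f t))).
Proof.
have discount := solves_odeZ gamma (solves_ode_expRM T (- theta)).
have := solves_odeM (solves_odeD discount (opt_Psi1 sys)) nonadopters_ode.
by apply: solves_ode_eq => t; rewrite /hazard /q; ring.
Qed.

Lemma nonadopters_norm_le (t : R) :
  horizon T t -> `|1 - f t| <= expR (- p0 * t).
Proof.
move=> tT.
have := solves_ode_norm_le (k := p0) nonadopters_ode _ tT.
rewrite (opt_f0 sys) subr0 normr1 mul1r; apply=> u u0 uT.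
by apply: hazard_ge; split; exact: ltW.
Qed.

(** * Decay rates on the infinite horizon *)

Section InfiniteHorizon.
Context (Too : T = +oo%E) (theta_gt0 : 0 < theta).

Let horizon_ge0 (t : R) : 0 <= t -> horizon T t.
Proof. by move=> t0; split => //; rewrite Too leey. Qed.

Let k_gt0 : 0 < theta + p0.
Proof. by rewrite addr_gt0. Qed.

Let expR_theta_p0 (t : R) :
  expR (- (theta + p0) * t) = expR (- theta * t) * expR (- p0 * t).
Proof. by rewrite -expRD; congr expR; ring. Qed.

Lemma adoption_cvg1 : f t @[t --> +oo] --> (1 : R).
Proof.
have g0 : 1 - f t @[t --> +oo] --> (0 : R).
  apply: (@cvg0_expR_bound _ _ 1 _ p0_gt0) => t t0.
  by rewrite mul1r nonadopters_norm_le//; exact: horizon_ge0.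
have -> : f = (fun t => 1 - (1 - f t)) by apply/funext => t; rewrite subKr.
by rewrite -[X in _ --> X](subr0 1); apply: cvgB => //; exact: cvg_cst.
Qed.

(** The integral over [0, +oo[ of theta gamma e^(-(theta + p0) u), which dominates the derivative in
    [value_ode]. *)
Let D := theta * gamma / (theta + p0).

Let D_ge0 : 0 <= D.
Proof. by rewrite ltW// divr_gt0// mulr_gt0. Qed.

Lemma discounted_value_le (t : R) : 0 <= t ->
  `|(gamma * expR (- theta * t) + Psi1 t) * (1 - f t)|
  <= D * expR (- (theta + p0) * t).
Proof.
move=> t0; have := value_ode; rewrite Too => ode.
apply: (solves_ode_cvg0_norm k_gt0 ode) t0 => [|u u0].
  have e0 : gamma * expR (- theta * s) @[s --> +oo] --> (0 : R).
    by rewrite -[X in _ --> X](mulr0 gamma); apply: cvgMl_tmp; exact: cvg_expRN.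
  have P0 : Psi1 s @[s --> +oo] --> (0 : R).
    by have := opt_Psi1T sys; rewrite Too.
  have g0 : 1 - f s @[s --> +oo] --> (0 : R).
    by rewrite -(subrr 1); apply: cvgB; [exact: cvg_cst|exact: adoption_cvg1].
  by have h := cvgM (cvgD e0 P0) g0; rewrite addr0 mulr0 in h; exact: h.
rewrite expR_theta_p0 mulrA normrN !normrM !(gtr0_norm theta_gt0).
rewrite (gtr0_norm gamma_gt0) (gtr0_norm (expR_gt0 _)) ler_wpM2l//.
  by rewrite ltW// !mulr_gt0// expR_gt0.
by apply: nonadopters_norm_le; exact/horizon_ge0/ltW.
Qed.

(** Undoing the discount costs e^(theta t), which the rate theta + p0 absorbs, leaving p0. *)
Lemma value_le (t : R) : 0 <= t -> `|value t| <= D * expR (- p0 * t).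
Proof.
move=> t0.
have -> : value t = expR (theta * t) *
    ((gamma * expR (- theta * t) + Psi1 t) * (1 - f t)).
  have e : expR (theta * t) * expR (- theta * t) = 1.
    by rewrite mulNr expRxMexpNx_1.
  by rewrite /value -[gamma in LHS]mulr1 -e; ring.
rewrite normrM (gtr0_norm (expR_gt0 _)).
have -> : D * expR (- p0 * t) =
    expR (theta * t) * (D * expR (- (theta + p0) * t)).
  by rewrite mulrCA -expRD; congr (_ * expR _); ring.
by rewrite ler_wpM2l ?expR_ge0// discounted_value_le.
Qed.

Lemma exposed_value_le (t : R) : 0 <= t ->
  `|value t * (1 - expR (- y t))| <= D * expR (- p0 * t).
Proof.
move=> t0; have /andP[e0 e1] := exposed_itv (horizon_ge0 t0).
rewrite normrM (ger0_norm e0).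
by apply: le_trans (value_le t0); rewrite ler_piMr.
Qed.

(** Since sqrt(s_q) is bq / 2 times the norm of the exposed value, it is at most bq / 2 times
    [D]. *)
Lemma internal_rate_itv (t : R) : 0 <= t -> 0 <= q t <= q0 + bq * (bq / 2 * D).
Proof.
move=> t0; apply/andP; split.
  by apply: le_trans (sqrt_rate_ge q0 (sq t) bq_gt0); exact: ltW.
rewrite lerD2l ler_pM2l// (opt_sq sys (horizon_ge0 t0)).
have -> : bq ^+ 2 / 4 = (bq / 2) ^+ 2 by field.
have b2 : 0 <= bq / 2 by rewrite ltW// divr_gt0.
rewrite -exprMn sqrtr_sqr normrM (ger0_norm b2) ler_wpM2l//.
apply: le_trans (exposed_value_le t0) _; rewrite ler_piMr//.
by rewrite -expR0 ler_expR mulNr oppr_le0 mulr_ge0// ltW.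
Qed.

(** The analogue of [D] for [Psi2]: the bound [D] on the discounted value, times the bound on [q],
    over the decay rate. *)
Let E := D * (q0 + bq * (bq / 2 * D)) / (theta + p0).

Lemma Psi2_le (t : R) : 0 <= t -> `|Psi2 t| <= E * expR (- (theta + p0) * t).
Proof.
move=> t0; have := opt_Psi2 sys; rewrite Too => ode.
apply: (solves_ode_cvg0_norm k_gt0 ode) t0 => [|u u0].
  by have := opt_Psi2T sys; rewrite Too.
have u0' := ltW u0.
have /andP[q_ge0 q_le] := internal_rate_itv u0'.
have e_le : expR (- y u) <= 1.
  by have /andP[+ _] := exposed_itv (horizon_ge0 u0'); rewrite subr_ge0.
set W := (gamma * expR (- theta * u) + Psi1 u) * (1 - f u).
(* The derivative of [Psi2] is regrouped as the decaying discounted value [W] times a bounded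
   factor. *)
have -> : - (gamma * expR (- theta * u) + Psi1 u) * (1 - f u)
    * sqrt_rate q0 bq (sq u) * expR (- y u) = - (W * (q u * expR (- y u))).
  by rewrite /W /q; ring.
rewrite normrN normrM [leRHS]mulrAC ler_pM// ?discounted_value_le//.
rewrite ger0_norm ?mulr_ge0 ?expR_ge0//.
by rewrite -[leRHS]mulr1 ler_pM ?expR_ge0.
Qed.

Lemma promotions_cvg0 :
  sp t @[t --> +oo] --> (0 : R) /\ sq t @[t --> +oo] --> (0 : R).
Proof.
(* Promotions are squares of quantities of order e^(-p0 t), so they decay at rate 2 p0. *)
have p2 : 0 < 2 * p0 by rewrite mulr_gt0.
have sqr_le (b C u t : R) : `|u| <= C * expR (- p0 * t) ->
    `|b ^+ 2 / 4 * u ^+ 2| <= b ^+ 2 / 4 * C ^+ 2 * expR (- (2 * p0) * t).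
  move=> uC; have b0 : 0 <= b ^+ 2 / 4 by rewrite divr_ge0 ?sqr_ge0.
  have -> : expR (- (2 * p0) * t) = expR (- p0 * t) ^+ 2.
    by rewrite -expRM_natl; congr expR; ring.
  rewrite -[leRHS]mulrA -exprMn normrM (ger0_norm b0) normrX ler_wpM2l//.
  by rewrite lerXn2r// nnegrE// (le_trans _ uC).
split.
  apply: (cvg0_expR_bound (C := bp ^+ 2 / 4 * (D + E) ^+ 2) p2) => t t0.
  rewrite (opt_sp sys (horizon_ge0 t0)); apply: sqr_le.
  apply: le_trans (ler_normD _ _) _; rewrite [leRHS]mulrDl.
  apply: lerD; first exact: value_le.
  (* Dividing by e^(theta t) restores the rate theta + p0 of [Psi2_le]. *)
  rewrite normrM (gtr0_norm (expR_gt0 _)) -ler_pdivlMr ?expR_gt0//.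
  rewrite -expRN -mulrA -expRD.
  have -> : - p0 * t - theta * t = - (theta + p0) * t by ring.
  exact: Psi2_le.
apply: (cvg0_expR_bound (C := bq ^+ 2 / 4 * D ^+ 2) p2) => t t0.
rewrite (opt_sq sys (horizon_ge0 t0)); apply: sqr_le.
exact: exposed_value_le.
Qed.

End InfiniteHorizon.
End OptimalitySystem.

Unset Implicit Arguments.

Theorem corollary10 (R : realType) (T : \bar R)
    (p0 q0 bp bq gamma theta : R) (sp sq f y Psi1 Psi2 : R -> R)
    (p0_gt0 : 0 < p0) (q0_gt0 : 0 < q0) (bp_gt0 : 0 < bp) (bq_gt0 : 0 < bq)
    (gamma_gt0 : 0 < gamma) (theta_ge0 : 0 <= theta)
    (T_gt0 : (0 < T)%E) (theta_gt0 : T = +oo%E -> 0 < theta)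
    (s_opt : optimal_promotion T (sqrt_rate p0 bp) (sqrt_rate q0 bq)
               gamma theta sp sq f)
    (s_sys : optimality_system T p0 q0 bp bq gamma theta sp sq f y Psi1 Psi2) :
  (forall T0 : R, T = T0%:E -> [/\ f T0 < 1, 0 < sp T0 & 0 < sq T0]) /\
  (T = +oo%E ->
     [/\ f t @[t --> +oo] --> (1 : R),
         sp t @[t --> +oo] --> (0 : R) &
         sq t @[t --> +oo] --> (0 : R)]).
Proof.
split=> [T0 TE|Too]; last first.
  have [sp0 sq0] := promotions_cvg0 p0_gt0 q0_gt0 bp_gt0 bq_gt0 gamma_gt0 s_sys
    Too (theta_gt0 Too).
  by split => //; exact: (adoption_cvg1 p0_gt0 q0_gt0 bp_gt0 bq_gt0 s_sys Too).
have T0_gt0 : 0 < T0 by rewrite -lte_fin -TE.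
have fT := adoption_lt1 s_sys T0_gt0 TE.
have hT : horizon T T0 by rewrite TE; split => //=; exact: ltW.
have yT : 0 < y T0.
  by apply: lt_le_trans (exposure_ge bp_gt0 s_sys hT); exact: mulr_gt0.
have ey : expR (- y T0) < 1 by rewrite -expR0 ltr_expR oppr_lt0.
(* With both costates zero at [T0], the promotions reduce to squares of gamma (1 - f), with the
   extra factor 1 - e^(-y) for [sq]; all these factors are positive. *)
have := opt_Psi1T s_sys; have := opt_Psi2T s_sys; rewrite TE /= => P2 P1.
split=> //.
- rewrite (opt_sp s_sys hT) P1 P2 !mul0r !addr0.
  by rewrite !mulr_gt0 ?invr_gt0 ?exprn_gt0 ?mulr_gt0 ?subr_gt0.
- rewrite (opt_sq s_sys hT) P1 mul0r addr0.
  by rewrite !mulr_gt0 ?invr_gt0 ?exprn_gt0 ?mulr_gt0 ?subr_gt0.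
Qed.
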